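(* Let $4<b<c$ be integers such that $4,b,c$ are pairwise coprime, and write $c=4p+qb$ with $p,q\in\mathbb{Z}$ and $0\leq q<4$. Let $Q$ be a point in the torus of $\mathbb{P}(4,b,c)$ and let $H$ be the generator of the Cartier class group of $\mathbb{P}(4,b,c)$. Assume $p<0$. Then \[ \gamma_Q(H)\geq\gamma_{\mathrm{expected}}(H)=\frac{\nu(D_0)}{m_0}, \] where $D_0$ and $\nu(D_0)$ are computed exactly as follows. Given these constraints, we have $2<\frac{b}{-p}<\frac{16}{3}$. Divide the interval $\left[2,\frac{16}{3}\right]$ into a countably infinite sequence of intervals of the form \[ I_k:=\left[\frac{16(k+1)^2}{8(k+1)^2-4(k+1)-1},\frac{16k^2}{8k^2-4k-1}\right] \] with $k\in\mathbb{Z}^+$. Then the class of $D_0\sim m_0H$ is given as follows, depending on the value of $\frac{b}{-p}\in I_k$: \begin{enumerate} \item If $\frac{b}{-p}\in I'_{k,-}:=\left[\frac{16(k+1)^2}{8(k+1)^2-4(k+1)-1},\frac{2k+1}{k}\right]$, then $D_0\sim\frac{2k+3}{c}H$ with $\nu(D_0)=4(k+1)$. \item If $\frac{b}{-p}\in I'_{k,+}:=\left[\frac{2k+1}{k},\frac{4(2k+1)^2}{8k^2+4k-1}\right]$, then $D_0\sim\frac{2k+1}{b}H$ with $\nu(D_0)=4(k+1)$. \item If $\frac{b}{-p}\in I''_{k,-}:=\left[\frac{4(2k+1)^2}{8k^2+4k-1},\frac{4k}{2k-1}\right]$, then $D_0\sim\frac{k+1}{c}H$ with $\nu(D_0)=2k+1$.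 \item If $\frac{b}{-p}\in I''_{k,+}:=\left[\frac{4k}{2k-1},\frac{16k^2}{8k^2-4k-1}\right]$, then $D_0\sim\frac{k}{b}H$ with $\nu(D_0)=2k+1$. \end{enumerate}
   Context: Work over an arbitrary field $F$ (points are $F$-rational). $\mathbb{P}(a,b,c)$ is the weighted projective surface with coordinates $x,y,z$ of weights $a,b,c$; its torus is the open set $xyz\neq 0$. $D_x,D_y,D_z$ are the Weil divisors defined by the vanishing of $x,y,z$. The generator $H$ of the Cartier class group satisfies $H\sim bcD_x\sim acD_y\sim abD_z$ (weighted degree $abc$). For $m\in\frac1b\mathbb{Z}^+\cup\frac1c\mathbb{Z}^+$, $mH$ denotes the Weil divisor class of weighted degree $m\,abc$ (so $\frac{n}{c}H\sim nbD_x$ and $\frac{n}{b}H\sim ncD_x$); $h^0(D)$ denotes the dimension of the space of global sections of a Weil divisor $D$. Effective threshold: for a projective variety $X$ over $F$, an $F$-rational $\mathbb{Q}$-divisor $D$ and an $F$-rational point $Q$ of $X$, let $\pi$ be the blowup of $X$ at $Q$ and $E$ its exceptional divisor; then $\gamma_Q(D):=\sup\{\gamma>0\mid \pi^*(D)-\gamma E\text{ is pseudo-effective}\}$. For any Weil divisor $D$, \[ \nu(D):=\max\left\{d\in\mathbb{Z}^+\;\middle|\; h^0(D)>\binom{d+1}{2}\right\}, \] and for $H$ the generator of the Cartier class group of $\mathbb{P}(a,b,c)$ with $a<b<c$, \[ \gamma_{\mathrm{expected}}(H):=\sup\left\{\frac{\nu(mH)}{m}\;\middle|\; m\in\tfrac{1}{b}\mathbb{Z}^+\cup\tfrac{1}{c}\mathbb{Z}^+\right\}.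 \]
   Formalization: The bound b/(-p)<16/3 fails in general (b=7, c=17, p=-1 gives 7), so it is assumed where b/(-p) is placed in some I_k; the intervals I_k cover (2,16/3], so the endpoint 2 is added separately to the division of [2,16/3]. *)

(* Defs.v *)
(* MathComp / MathComp-Analysis.  The notations of multinomials clash with those
   of MathComp-Analysis, hence the import of mpoly without its notations:
   mpoly 3 F is the polynomial ring F[x, y, z] and multinom 3 the type of its
   exponent vectors. *)
From HB Require Import structures.
From mathcomp Require Import all_boot all_order all_algebra.
From mathcomp Require Import all_classical all_reals all_analysis.
From mathcomp Require mpoly.
Import -(notations) mpoly.

Set Implicit Arguments.
Unset Strict Implicit.
Unset Printing Implicit Defensive.

Import Order.TTheory GRing.Theory Num.Theory.
Import numFieldNormedType.Exports.
Local Open Scope classical_set_scope.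
Local Open Scope ring_scope.

Definition has_dim (F : fieldType) (V : lmodType F) (S : set V) (d : nat) : Prop :=
  exists e : 'I_d -> V,
    [/\ forall i, S (e i),
        forall l : 'I_d -> F, \sum_i l i *: e i = 0 -> forall i, l i = 0 &
        forall v, S v -> exists l : 'I_d -> F, v = \sum_i l i *: e i].

(* The weighted projective plane P(a,b,c), for pairwise coprime positive weights.
   Its divisor class group is Z (weighted degree), so a Weil divisor class is
   represented by its weighted degree n, and the global sections of that class
   are the weighted homogeneous polynomials of degree n. *)
Definition weight (a b c : nat) : 'I_3 -> nat := tnth [tuple a; b; c].

Definition wdeg (a b c : nat) (u : multinom 3) : nat :=
  (\sum_(i < 3) weight a b c i * u i)%N.

Definition sections (F : fieldType) (a b c n : nat) : set (mpoly 3 F) :=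
  [set f | forall u : multinom 3, u \in msupp f -> wdeg a b c u = n].
Arguments sections F a b c n : clear implicits.

(* The default 0 of xget is never used when the weights are positive. *)
Definition h0 (F : fieldType) (a b c n : nat) : nat :=
  xget 0%N [set d | has_dim (sections F a b c n) d].

(* Since d <= 'C(d.+1, 2), restricting to d < h0 loses nothing.  When no d
   qualifies (h0 <= 1) the value is 0. *)
Definition nu (F : fieldType) (a b c n : nat) : nat :=
  (\max_(d < h0 F a b c n | (0 < d) && ('C(d.+1, 2) < h0 F a b c n)) d)%N.

(* "D ~ mH": the class H has weighted degree abc. *)
Definition class_mH (R : realType) (a b c : nat) (m : R) (D : nat) : Prop :=
  D%:R = m * (a * b * c)%:R.

Definition multiples (R : realType) (b c : nat) : set R :=
  [set m | exists2 n : nat, (0 < n)%N & m = n%:R / b%:R \/ m = n%:R / c%:R].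

Definition gamma_expected (R : realType) (F : fieldType) (a b c : nat) : \bar R :=
  ereal_sup [set r | exists m : R, exists D : nat,
    [/\ multiples b c m, class_mH a b c m D &
        r = ((nu F a b c D)%:R / m)%:E]].

(* The blowup pi : X -> P(a,b,c) at an F-rational point of the torus.

   Homogeneous coordinates: as gcd(a,b,c) = 1, every F-rational point of the torus
   is the class of a triple Q of nonzero elements of F, and A^3 \ {0} -> P(a,b,c)
   is a G_m-torsor over the torus.  It is therefore smooth there, so the
   multiplicity of the curve f = 0 at the point is the order of vanishing of f at
   Q in A^3, i.e. the least degree of a monomial of f(x + Q). *)
Definition translate (F : fieldType) (Q : 'I_3 -> F) (f : mpoly 3 F) : mpoly 3 F :=
  comp_mpoly [tuple mpolyX F (mnm1 i) + mpolyC 3 (Q i) | i < 3] f.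

Definition vanishes_to (F : fieldType) (Q : 'I_3 -> F) (e : int) (f : mpoly 3 F)
    : Prop :=
  forall u : multinom 3, (mdeg u)%:Z < e -> mcoeff u (translate Q f) = 0.

(* The real Neron-Severi space of X has basis pi^*H, E; the pair (s, t) : R * R
   stands for s pi^*H + t E.  Every effective Weil divisor on X is of the form
   pi^*{f = 0} - e E with f a nonzero section of some degree n and e an integer,
   and such a divisor is effective iff e is at most the multiplicity of f at the
   point (so e may be negative).  Its class is (n / abc) pi^*H - e E. *)
Definition effective_class (R : realType) (F : fieldType) (a b c : nat)
    (Q : 'I_3 -> F) : set (R * R) :=
  [set D | exists n : nat, exists f : mpoly 3 F, exists e : int,
    [/\ f != 0, sections F a b c n f, vanishes_to Q e f &
        D = (n%:R / (a * b * c)%:R, - e%:~R)]].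

Definition effective_cone (R : realType) (F : fieldType) (a b c : nat)
    (Q : 'I_3 -> F) : set (R * R) :=
  [set v | exists n : nat, exists r : 'I_n -> R, exists D : 'I_n -> R * R,
    [/\ forall i, 0 <= r i, forall i, effective_class a b c Q (D i) &
        v = (\sum_i r i * (D i).1, \sum_i r i * (D i).2)]].

Definition pseudo_effective (R : realType) (F : fieldType) (a b c : nat)
    (Q : 'I_3 -> F) : set (R * R) :=
  closure (effective_cone (R := R) a b c Q).

(* gamma_Q(sH), from the class s pi^*H - g E. *)
Definition gamma_Q (R : realType) (F : fieldType) (a b c : nat)
    (Q : 'I_3 -> F) (s : R) : \bar R :=
  ereal_sup [set g%:E | g in [set g : R |
    0 < g /\ pseudo_effective a b c Q (s, - g)]].

Definition computed_by (R : realType) (F : fieldType) (a b c : nat) (m0 : R)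
    (d : nat) : Prop :=
  exists D0 : nat, [/\ class_mH a b c m0 D0, nu F a b c D0 = d &
    gamma_expected R F a b c = ((nu F a b c D0)%:R / m0)%:E].

Definition I_end (R : realType) (k : nat) : R :=
  16%:R * k%:R ^+ 2 / (8%:R * k%:R ^+ 2 - 4%:R * k%:R - 1).

Definition I_mid (R : realType) (k : nat) : R :=
  4%:R * (2%:R * k%:R + 1) ^+ 2 / (8%:R * k%:R ^+ 2 + 4%:R * k%:R - 1).

Definition I_ (R : realType) (k : nat) : set R := `[I_end R k.+1, I_end R k].

Definition I'_minus (R : realType) (k : nat) : set R :=
  `[I_end R k.+1, (2%:R * k%:R + 1) / k%:R].

Definition I'_plus (R : realType) (k : nat) : set R :=
  `[(2%:R * k%:R + 1) / k%:R, I_mid R k].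

Definition I''_minus (R : realType) (k : nat) : set R :=
  `[I_mid R k, 4%:R * k%:R / (2%:R * k%:R - 1)].

Definition I''_plus (R : realType) (k : nat) : set R :=
  `[4%:R * k%:R / (2%:R * k%:R - 1), I_end R k].

Arguments I_ R k : clear implicits.
Arguments I'_minus R k : clear implicits.
Arguments I'_plus R k : clear implicits.
Arguments I''_minus R k : clear implicits.
Arguments I''_plus R k : clear implicits.

(* Main.v *)
(* Write d0 = S + S', where (S, S') is (k+1, k) or (2k+3, 2k+1).  As q = 3, the sections of a class
   of degree D divisible by 4 are spanned by the monomials x^i y^j z^k with j = k mod 4 and
   bj + ck <= D, so h^0 counts lattice points of a triangle.

   Lower bound: for D = D_0 this triangle contains the lattice triangle S'j + Sk <= 4SS', which has
   exactly one point more than 1 + 2 + ... + d0.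

   Upper bound: if d exceeds (d0 / m_0) m, a triangle has at most 1 + 2 + ... + d points.  Cut it into
   strips of width 4S' (or 4S), whose removal is the subtraction of D_0, replacing d by d - d0.  In a
   strip, the form S'j + Sk is smaller than d0 d, and at most min(e+1, d0) points of the strip have
   d0 e <= S'j + Sk < d0 (e+1); these numbers add up to C(d+1, 2) - C(d-d0+1, 2).

   Vanishing to order n at a torus point is only C(n+1, 2) linear conditions on a section, in every
   characteristic: the exponents of the monomials of given degree are affine functions of two integer
   coordinates, so the Taylor coefficients of order < n at the point are combinations of sums of the
   coefficients against integer-valued polynomials of degree < n in two variables, and these are
   combinations of products of two binomial coefficients (Newton interpolation).

   In terms of t = b / (-p) one has c / b = 3 - 4 / t; the end points of the intervals express the
   equalities c / b = S / S' and m_0 (4bc)^(1/2) = d0. *)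
Require Import Defs.
From HB Require Import structures.
From mathcomp Require Import all_boot all_order all_algebra.
From mathcomp Require Import all_classical all_reals all_analysis.
From mathcomp Require mpoly.
Import -(notations) mpoly.
From mathcomp Require Import zify ring lra.

Set Implicit Arguments.
Unset Strict Implicit.
Unset Printing Implicit Defensive.

Import Order.TTheory GRing.Theory Num.Theory.
Import numFieldNormedType.Exports.

(** * Lattice points in triangles *)

(** A cardinality bound through duplicate-free lists makes sense for predicates on infinite types
    and needs no prior proof of finiteness. *)
Definition at_most (T : eqType) (P : pred T) (m : nat) : Prop :=
  forall s : seq T, uniq s -> all P s -> size s <= m.

Lemma at_mostU (T : eqType) (P1 P2 Q P : pred T) (m1 m2 : nat) :
  (forall x, P x -> Q x -> P1 x) -> (forall x, P x -> ~~ Q x -> P2 x) ->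
  at_most P1 m1 -> at_most P2 m2 -> at_most P (m1 + m2).
Proof.
move=> h1 h2 b1 b2 s us /allP hs.
rewrite -(count_predC Q s) -!size_filter leq_add //.
  apply: b1; rewrite ?filter_uniq //; apply/allP => x.
  by rewrite mem_filter => /andP[Qx /hs Px]; apply: h1.
apply: b2; rewrite ?filter_uniq //; apply/allP => x.
by rewrite mem_filter => /andP[Qx /hs Px]; apply: h2.
Qed.

Lemma at_most_map (T T' : eqType) (f : T -> T') (P : pred T) (P' : pred T') (m : nat) :
  (forall x, P x -> P' (f x)) ->
  (forall x y, P x -> P y -> f x = f y -> x = y) ->
  at_most P' m -> at_most P m.
Proof.
move=> fP injf b s us /allP hs; rewrite -(size_map f); apply: b.
  by rewrite map_inj_in_uniq // => x y /hs Px /hs Py; apply: injf.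
by apply/allP => _ /mapP[x /hs Px ->]; apply: fP.
Qed.

Lemma at_most_inj (T : eqType) (f : T -> nat) (P : pred T) (m : nat) :
  (forall x, P x -> f x < m) ->
  (forall x y, P x -> P y -> f x = f y -> x = y) -> at_most P m.
Proof.
move=> fP injf; apply: (at_most_map (P' := fun i => i < m) fP injf) => s us /allP hs.
by rewrite -(size_iota 0 m); apply: uniq_leq_size => // x /hs; rewrite mem_iota.
Qed.

Lemma at_most0 (T : eqType) (P : pred T) (m : nat) : (forall x, ~~ P x) -> at_most P m.
Proof. by move=> P0 [|x s] //= _ /andP[Px]; rewrite (negPf (P0 x)) in Px. Qed.


(* The pairs (S', S) and (S, S'); the coefficient A is the one of the coordinate j, so that the lattice
   triangle Aj + Bk <= 4AB has vertices (4B, 0) and (0, 4A). *)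
Definition good_pair (A B : nat) : Prop := exists2 h : nat, 0 < h &
  [\/ A = h /\ B = h.+1, A = h.+1 /\ B = h,
      A = h.*2.+1 /\ B = h.*2.+3 | A = h.*2.+3 /\ B = h.*2.+1].

Definition in_strip (A : nat) (x : nat * nat) : bool :=
  (x.1 %% 4 == x.2 %% 4) && (x.2 < 4 * A).

Definition slab (A B d : nat) (x : nat * nat) : bool :=
  in_strip A x && ((A + B) * d <= A * x.1 + B * x.2 < (A + B) * d.+1).

Lemma eq_mod4_int (j k : nat) : j %% 4 == k %% 4 -> exists a : int, Posz j = (Posz k + 4 * a)%R.
Proof. by move=> jk; exists ((Posz j - Posz k) %/ 4)%Z; lia. Qed.



Lemma level_dvd4 (A B j k : nat) :
  4 %| A + B -> j %% 4 == k %% 4 -> 4 %| A * j + B * k.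
Proof.
move=> dAB /eqP jk; rewrite (divn_eq j 4) (divn_eq k 4) jk.
have -> : A * (j %/ 4 * 4 + k %% 4) + B * (k %/ 4 * 4 + k %% 4) =
  4 * (A * (j %/ 4) + B * (k %/ 4)) + (A + B) * (k %% 4) by lia.
by rewrite dvdn_add ?dvdn_mulr.
Qed.

Lemma good_pair_cases (A B : nat) : good_pair A B ->
  [/\ 1 < A + B, 0 < A & (odd (A + B) /\ (A = B.+1 \/ B = A.+1)) \/
    [/\ 4 %| A + B, odd A & (A = B.+2 \/ B = A.+2)]].
Proof.
have d1 h : h.*2.+1 + h.*2.+3 = h.+1 * 4 by lia.
have d2 h : h.*2.+3 + h.*2.+1 = h.+1 * 4 by lia.
case=> h h0 [] [-> ->]; split; try lia.
  by right; split; [rewrite d1 dvdn_mull|rewrite /= odd_double|right].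
by right; split; [rewrite d2 dvdn_mull|rewrite /= odd_double|left].
Qed.


(** Equal levels give A(j - j') = B(k' - k), so (A + B)(k' - k) is A times (j - j') + (k' - k), a
    multiple of 4 by the congruences. *)
Lemma same_level_dvd (A B j k j' k' : nat) : 0 < A ->
  j %% 4 == k %% 4 -> j' %% 4 == k' %% 4 -> k <= k' ->
  A * j + B * k = A * j' + B * k' -> 4 * A %| (A + B) * (k' - k).
Proof.
move=> A0 jk jk' lek e.
have e1 : A * j = A * j' + B * (k' - k) by rewrite mulnBr; nia.
have lej : j' <= j by rewrite -(leq_pmul2l A0) e1 leq_addr.
have e2 : A * (j - j') = B * (k' - k) by rewrite mulnBr e1 addKn.
have -> : (A + B) * (k' - k) = (j - j' + (k' - k)) * A by rewrite mulnDl -e2; lia.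
by rewrite dvdn_pmul2r //; lia.
Qed.

(** For odd A + B the level alone determines the point of the strip, as 4A and A + B are coprime.
    Otherwise every level is a multiple of 4 and carries at most four points, told apart by
    [k %/ A], since A is coprime to (A + B) / 4; this quotient fills the gaps between multiples of
    4. *)
Lemma slab_le_sum (A B d : nat) : good_pair A B -> at_most (slab A B d) (A + B).
Proof.
move=> /good_pair_cases[AB1 A0 hAB].
pose f (x : nat * nat) := A * x.1 + B * x.2 - (A + B) * d + (if odd (A + B) then 0 else x.2 %/ A).
apply: (at_most_inj (f := f)); rewrite /f /slab /in_strip.
  move=> [j k] /= /andP[/andP[jk hk] /andP[h1 h2]].
  have : k %/ A < 4 by rewrite ltn_divLR.
  case: hAB => [[-> _] _|[dAB oA _]]; first by rewrite addn0 ltn_subLR // -mulnSr.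
  have -> : odd (A + B) = false by case/dvdnP: dAB => g ->; rewrite oddM andbF.
  move: (level_dvd4 dAB jk) h1 h2 => /dvdnP[w ->].
  case/dvdnP: dAB => g ->. rewrite (mulnSr _ d) (mulnAC _ 4 d).
  by move: (g * d) (k %/ A) => x y; clear; lia.
suff H j k j' k' : j %% 4 == k %% 4 -> j' %% 4 == k' %% 4 -> k' < 4 * A -> k <= k' ->
    A * j + B * k = A * j' + B * k' -> (~~ odd (A + B) -> k %/ A = k' %/ A) -> (j, k) = (j', k').
  move=> [j k] [j' k'] /= /andP[/andP[jk hk] /andP[h1 _]].
  move=> /andP[/andP[jk' hk'] /andP[h1' _]] e.
  have [e1 e2] : A * j + B * k = A * j' + B * k' /\ (~~ odd (A + B) -> k %/ A = k' %/ A).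
    case: hAB e => [[-> _]|[dAB _ _]]; first by rewrite !addn0; split=> //; lia.
    have -> : odd (A + B) = false by case/dvdnP: dAB => g ->; rewrite oddM andbF.
    have hq : k %/ A < 4 by rewrite ltn_divLR.
    have hq' : k' %/ A < 4 by rewrite ltn_divLR.
    move: (level_dvd4 dAB jk) (level_dvd4 dAB jk') h1 h1' => /dvdnP[w ->] /dvdnP[w' ->].
    have : 4 %| (A + B) * d by apply: dvdn_mulr.
    case/dvdnP=> z ->; move: (k %/ A) (k' %/ A) hq hq' => x y; clear; lia.
  case: (leqP k k') => [lek|/ltnW lek]; first exact: H.
  by apply/esym; apply: H => // nod; rewrite e2.
move=> jk jk' hk' lek e eq.
suff ek : k = k'.
  by move: e; rewrite ek => /addIn/eqP; rewrite eqn_pmul2l // => /eqP ->.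
have := same_level_dvd A0 jk jk' lek e.
case: hAB => [[oAB hAB]|[dAB oA hAB]].
  have cop : coprime (4 * A) (A + B).
    rewrite coprimeMl (coprimeXl 2 (m := 2)) ?coprime2n //=.
    rewrite /coprime gcdnDl -/(coprime _ _).
    by case: hAB => ->; rewrite ?coprimenS ?coprimeSn.
  rewrite Gauss_dvdr // => hd.
  have : k' - k = 0 by apply/eqP; apply: contraLR hd; rewrite -lt0n => h; rewrite gtnNdvd //; lia.
  by move: lek; clear; lia.
have eqk : k %/ A = k' %/ A by apply: eq; case/dvdnP: dAB => g ->; rewrite oddM andbF.
case/dvdnP: dAB => g hg; rewrite hg mulnAC -[4 * A]mulnC dvdn_pmul2r // => hd.
have cop : coprime A g.
  apply: (@coprime_dvdr _ (g * 2)); first exact: dvdn_mulr.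
  case: hAB => hAB; first by have -> : A = (g * 2).+1 by [lia]; apply: coprimeSn.
  by have -> : g * 2 = A.+1 by [lia]; apply: coprimenS.
move: hd; rewrite Gauss_dvdr // => hd.
rewrite (divn_eq k A) (divn_eq k' A) eqk; congr (_ + _).
by apply/esym/eqP; rewrite eqn_mod_dvd.
Qed.

(* With v = (j + k) / 2 and x = +-(j - k) / 4, the form Aj + Bk is rv - 2x, where r = A + B is odd, or
   2(rv - 2x), where A + B = 2r; and j, k >= 0 means |2x| <= v. *)
Definition skew_slab (r d : nat) (p : int * int) : bool :=
  [&& - p.1 <= p.2 *+ 2, p.2 *+ 2 <= p.1,
      r%:Z * d%:Z <= r%:Z * p.1 - p.2 *+ 2 & r%:Z * p.1 - p.2 *+ 2 < r%:Z * d%:Z + r%:Z]%R.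

(** The slab meets two rows v, selected by the sign of x. The third case is a vertex of the lattice
    triangle, one row higher. *)
Lemma skew_slab_lt (r d : nat) (v x : int) : 2 < r -> d < r -> skew_slab r d (v, x) ->
  [\/ (x <= 0 /\ v = d)%R, (0 < x /\ v = d.+1)%R | (x *+ 2 = r%:Z + 1 /\ d.+1 = r /\ v = d.+2)%R].
Proof.
rewrite /skew_slab /= => r2 dr /and4P[h1 h2 h3 h4].
have v0 : (0 <= v)%R by lia.
have : (v <= d%:Z + 2)%R by nia.
have : (d%:Z - 1 <= v)%R by nia.
move=> hv1 hv2.
have : (v = d%:Z - 1 \/ v = d \/ v = d%:Z + 1 \/ v = d%:Z + 2)%R by lia.
case=> [|[|[|]]] e; subst.
- exfalso; nia.
- by constructor 1; nia.
- constructor 2; nia.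
- constructor 3; nia.
Qed.

(** Now |2x| <= v lets |2x| pass r, so the slab reaches one further row on either side; row d + 3 is
    reached only at a vertex. *)
Lemma skew_slab_ge (r d : nat) (v x : int) : 3 < r -> r <= d < r.*2 -> skew_slab r d (v, x) ->
  [\/ (x <= 0 /\ x *- 2 < r%:Z /\ v = d)%R,
      (r%:Z <= x *- 2 < d%:Z /\ v = d%:Z - 1)%R, 
      (0 < x /\ x *+ 2 <= r%:Z /\ v = d.+1)%R | 
      (r%:Z < x *+ 2 /\ (x *+ 2 <= r%:Z *+ 2 /\ v = d.+2 \/
          x *+ 2 = r%:Z * 2 + 2 /\ d.+1 = r.*2 /\ v = d%:Z + 3))%R].
Proof.
rewrite /skew_slab /= => r2 dr /and4P[h1 h2 h3 h4].
have v0 : (0 <= v)%R by lia.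
have : (v <= d%:Z + 3)%R by nia.
have : (d%:Z - 1 <= v)%R by nia.
move=> hv1 hv2.
have : (v = d%:Z - 1 \/ v = d \/ v = d%:Z + 1 \/ v = d%:Z + 2 \/ v = d%:Z + 3)%R by lia.
case=> [|[|[|[]]]] e; subst.
- constructor 2; nia.
- by constructor 1; nia.
- constructor 3; nia.
- constructor 4; nia.
- constructor 4; nia.
Qed.

(* The condition on 2x removes one of the two vertices (4B, 0), (0, 4A) of the lattice triangle. *)
Lemma skew_slab_count_lt (r d : nat) (e : bool) : 2 < r -> d < r ->
  at_most (fun p : int * int => skew_slab r d p &&
    (if e then p.2 *+ 2 != r%:Z + 1 else p.2 *- 2 != r%:Z - 1)%R) d.+1.
Proof.
move=> r2 dr.
(* Even indices serve x <= 0 and odd ones x > 0. The vertex 2x = r + 1 would get [d.+1]; it takes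
   [d], left vacant by the opposite vertex when that one is excluded. *)
pose f (p : int * int) : nat := (if (p.2 <= 0)%R then absz (p.2 *+ 2)%R
  else if (p.2 *+ 2 == r%:Z + 1)%R then d else (absz (p.2 *+ 2)%R).-1).
apply: (at_most_inj (f := f)); rewrite /f.
  move=> [v x] /= /andP[h _]; case: (skew_slab_lt r2 dr h) => H;
  move: h; rewrite /skew_slab /=; repeat case: ifP; move=> *; lia.
move=> [v x] [v' x'] /= /andP[h he] /andP[h' he'].
have := skew_slab_lt r2 dr h; have := skew_slab_lt r2 dr h'.
move: h h'; rewrite /skew_slab /= => h h' H1 H2 E.
suff : v = v' /\ x = x' by case=> -> ->.
by case: e he he' E; repeat case: ifP; move=> *; case: H1 => H1; case: H2 => H2; lia.
Qed.

Lemma skew_slab_count_ge (r d : nat) (e : bool) : 3 < r -> ~~ odd r -> r <= d < r.*2 ->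
  at_most (fun p : int * int => skew_slab r d p &&
    (if e then p.2 *+ 2 != r%:Z * 2 + 2 else p.2 *- 2 != r%:Z * 2 - 2)%R) d.+1.
Proof.
move=> r2 ro dr.
have {ro} [q rE] : exists q, r = q.*2 by exists r./2; lia.
(* The parities are exchanged: odd indices for x <= 0, even ones for x > 0. Again the vertex moves
   from [d.+1] to [d]. *)
pose f (p : int * int) : nat := (if (p.2 <= 0)%R then (absz (p.2 *+ 2)%R).+1
  else if (p.2 *+ 2 == r%:Z * 2 + 2)%R then d else (absz (p.2 *+ 2)%R) - 2).
apply: (at_most_inj (f := f)); rewrite /f.
  move=> [v x] /= /andP[h _]; case: (skew_slab_ge r2 dr h) => H;
  move: h; rewrite /skew_slab /=; repeat case: ifP; move=> *; lia.
move=> [v x] [v' x'] /= /andP[h he] /andP[h' he'].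
have := skew_slab_ge r2 dr h; have := skew_slab_ge r2 dr h'.
move: h h'; rewrite /skew_slab /= => h h' H1 H2 E.
suff : v = v' /\ x = x' by case=> -> ->.
by case: e he he' E; repeat case: ifP; move=> *; case: H1 => H1; case: H2 => H2; lia.
Qed.

Definition skew (A B : nat) (p : nat * nat) : int * int :=
  (p.2%:Z + ((p.1%:Z - p.2%:Z) %/ 4)%Z *+ 2,
   if (A < B)%N then ((p.1%:Z - p.2%:Z) %/ 4)%Z else - ((p.1%:Z - p.2%:Z) %/ 4)%Z)%R.

Lemma skew_inj (A B : nat) (p q : nat * nat) :
  p.1 %% 4 == p.2 %% 4 -> q.1 %% 4 == q.2 %% 4 -> skew A B p = skew A B q -> p = q.
Proof.
case: p q => [j k] [j' k'] /= /eq_mod4_int[a ha] /eq_mod4_int[a' ha'].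
rewrite /skew /=.
have -> : ((j%:Z - k%:Z) %/ 4)%Z = a by lia.
have -> : ((j'%:Z - k'%:Z) %/ 4)%Z = a' by lia.
by case; case: ifP => _ e1 e2; congr (_, _); lia.
Qed.

(** The strip excludes the vertex (0, 4A), whose x is positive exactly when A > B; the flag [e]
    records this. *)
Lemma slab_le_index (A B d : nat) : good_pair A B -> d < A + B -> at_most (slab A B d) d.+1.
Proof.
case=> h h0 hAB dAB.
have red (P : pred (int * int)) : at_most P d.+1 ->
    (forall j k (a : int), (0 <= k%:Z + 4 * a)%R -> j = absz (k%:Z + 4 * a)%R -> k < 4 * A ->
       ((A + B) * d)%N <= A * j + B * k < (A + B) * d.+1 ->
      P (k%:Z + a *+ 2, if (A < B)%N then a else - a)%R) -> at_most (slab A B d) d.+1.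
  move=> hP hs; apply: (at_most_map (f := skew A B) _ _ hP).
    move=> [j k] /andP[/andP[/= /eq_mod4_int[a ha] hk] hl].
    rewrite /skew /=.
    have -> : ((j%:Z - k%:Z) %/ 4)%Z = a by lia.
    by apply: hs hl => //; lia.
  by move=> p q /andP[/andP[hp _] _] /andP[/andP[hq _] _]; apply: skew_inj.
have oddcase r e : 2 < r -> d < r -> 
    (forall j k (a : int), (0 <= k%:Z + 4 * a)%R -> j = absz (k%:Z + 4 * a)%R -> k < 4 * A ->
       ((A + B) * d)%N <= A * j + B * k < (A + B) * d.+1 ->
       skew_slab r d (k%:Z + a *+ 2, if (A < B)%N then a else - a)%R &&
    (if e then (if (A < B)%N then a else - a) *+ 2 != r%:Z + 1 
      else (if (A < B)%N then a else - a) *- 2 != r%:Z - 1)%R) -> at_most (slab A B d) d.+1.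
  by move=> r2 dr H; refine (red _ (@skew_slab_count_lt r d e r2 dr) _) =>
    j k a h1 h2 h3 h4; apply: (H j k a).
have evencase r e : 3 < r -> ~~ odd r -> r <= d < r.*2 -> 
    (forall j k (a : int), (0 <= k%:Z + 4 * a)%R -> j = absz (k%:Z + 4 * a)%R -> k < 4 * A ->
       ((A + B) * d)%N <= A * j + B * k < (A + B) * d.+1 ->
       skew_slab r d (k%:Z + a *+ 2, if (A < B)%N then a else - a)%R &&
    (if e then (if (A < B)%N then a else - a) *+ 2 != r%:Z * 2 + 2 
      else (if (A < B)%N then a else - a) *- 2 != r%:Z * 2 - 2)%R) -> at_most (slab A B d) d.+1.
  by move=> r2 ro dr H; refine (red _ (@skew_slab_count_ge r d e r2 ro dr) _) =>
    j k a h1 h2 h3 h4; apply: (H j k a).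
case: hAB => -[? ?]; subst A B.
- apply: (@oddcase (h.*2.+1) false); try lia.
  move=> j k a h1 h2 h3 h4; rewrite ltnSn /skew_slab /=; nia.
- apply: (@oddcase (h.*2.+1) true); try lia.
  move=> j k a h1 h2 h3 h4; rewrite ltnNge leqnSn /skew_slab /=; nia.
(* Here A + B = 2r with r = 2(h + 1), and d < A + B splits at r. *)
- case: (ltnP d (h.+1).*2) => hd.
    apply: (@oddcase (h.+1).*2 false); try lia.
    move=> j k a h1 h2 h3 h4; rewrite /skew_slab; have -> : h.*2.+1 < h.*2.+3 by lia.
    rewrite /=; nia.
  apply: (@evencase (h.+1).*2 false); try lia.
  move=> j k a h1 h2 h3 h4; rewrite /skew_slab; have -> : h.*2.+1 < h.*2.+3 by lia.
  rewrite /=; nia.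
- case: (ltnP d (h.+1).*2) => hd.
    apply: (@oddcase (h.+1).*2 true); try lia.
    move=> j k a h1 h2 h3 h4; rewrite /skew_slab; have -> : h.*2.+3 < h.*2.+1 = false by lia.
    rewrite /=; nia.
  apply: (@evencase (h.+1).*2 true); try lia.
  move=> j k a h1 h2 h3 h4; rewrite /skew_slab; have -> : h.*2.+3 < h.*2.+1 = false by lia.
  rewrite /=; nia.
Qed.

Lemma strip_count (A B d : nat) : good_pair A B ->
  at_most (fun x => in_strip A x && (A * x.1 + B * x.2 < (A + B) * d))
    (\sum_(i < d) minn i.+1 (A + B)).
Proof.
move=> gAB; elim: d => [|d IHd]; first by apply: at_most0 => x; rewrite muln0 andbF.
rewrite big_ord_recr /=.
apply: (at_mostU (Q := fun x => A * x.1 + B * x.2 < (A + B) * d) _ _ IHd (P2 := slab A B d)).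
- by move=> x /andP[-> _] ->.
- by move=> x /andP[h1 h2]; rewrite -leqNgt /slab h1 h2 => ->.
case: (leqP d.+1 (A + B)) => hd; first exact: slab_le_index.
exact: slab_le_sum.
Qed.

(** Truncation at [e] makes the term i + 1 lose i + 1 - e, and these losses are 1, 2, ..., d - e. *)
Lemma sum_min_bin (e d : nat) :
  \sum_(i < d) minn i.+1 e + 'C((d - e).+1, 2) = 'C(d.+1, 2).
Proof.
elim: d => [|d IHd]; first by rewrite big_ord0.
rewrite big_ord_recr /= [in RHS]binS bin1 -IHd.
case: (leqP d.+1 e) => hd.
  have -> : d.+1 - e = 0 by lia.
  have -> : d - e = 0 by lia.
  by rewrite addnAC.
by rewrite subSn // [in LHS]binS bin1 addnACA; congr (_ + _); lia.
Qed.

(** For m_0 = A / beta, [4 * gamma * A] is the degree of D_0 and A + B is d0. Shifting k by 4A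
    lowers D by this degree and d by d0, which preserves the last hypothesis; hence strong induction
    on d. *)
Lemma triangle_count_le (A B beta gamma d D : nat) : good_pair A B ->
  B * beta <= A * gamma -> 4 * A ^ 2 * gamma <= (A + B) ^ 2 * beta ->
  (A + B) * D < 4 * gamma * A * d ->
  at_most (fun x => (x.1 %% 4 == x.2 %% 4) && (beta * x.1 + gamma * x.2 <= D)) 'C(d.+1, 2).
Proof.
move=> gAB hB hA; have [A0 B0] : 0 < A /\ 0 < B by case: gAB => h h0; case; lia.
elim/ltn_ind: d D => d IHd D hD.
rewrite -(sum_min_bin (A + B) d).
apply: (at_mostU (Q := fun x => x.2 < 4 * A) _ _ (strip_count (d := d) gAB)
  (P2 := fun x => [&& x.1 %% 4 == x.2 %% 4, 4 * A <= x.2 & beta * x.1 + gamma * x.2 <= D])).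
- move=> [j k] /= /andP[jk hjk] hk; rewrite /in_strip /= jk hk /=.
  (* In the strip [hB] compares the two linear forms, and [hA] then turns the bound on D into Aj +
     Bk < (A + B)d. *)
  have h1 : beta * (A * j + B * k) <= A * D.
    by have := leq_mul (leqnn A) hjk; have := leq_mul hB (leqnn k); nia.
  have h2 : beta * (A + B) * (A * j + B * k) < beta * (A + B) * ((A + B) * d).
    apply: leq_ltn_trans (_ : A * ((A + B) * D) < _); first by nia.
    apply: leq_trans (_ : A * (4 * gamma * A * d) <= _); first by rewrite ltn_pmul2l.
    by have := leq_mul hA (leqnn d); nia.
  by rewrite ltn_mul2l in h2; case/andP: h2.
- by move=> [j k] /= /andP[-> ->]; rewrite -leqNgt => ->.
(* Either nothing lies beyond the strip, or d > A + B and the subtractions below are exact. *)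
have [DA|AD] := ltnP D (4 * gamma * A).
  by apply: at_most0 => -[j k] /=; apply/negP => /and3P[_ h1 h2]; nia.
have hd : A + B < d by rewrite -(@ltn_pmul2l (4 * gamma * A)) ?(leq_ltn_trans _ hD); nia.
apply: (at_most_map (f := fun x => (x.1, x.2 - 4 * A)) _ _
  (IHd (d - (A + B)) _ (D - 4 * gamma * A) _)).
- move=> [j k] /= /and3P[jk h1 h2]; apply/andP; split; first by lia.
  by rewrite mulnBr; nia.
- move=> [j k] [j' k'] /= /and3P[_ h1 _] /and3P[_ h2 _] [-> e]; congr (_, _); lia.
- by lia.
- by rewrite !mulnBr [(A + B) * (4 * _ * _)]mulnC ltn_sub2r // ltn_pmul2l; nia.
Qed.

(* Indexes the points of the lattice triangle other than (4B, 0) by the pairs i <= d < A + B.  Row d of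
   points j + k = 2d is half filled by the even i, and row d.+1 by the odd i; for A + B = 2r, those of
   row 2r - 1 which fall outside the triangle are moved to row 2r + 1. *)
Definition fill (r d i : nat) : nat * nat :=
  if odd i then (d + i + 2, d - i)
  else if [&& ~~ odd r, d == r.*2.-1 & r <= i] then (d + i + 4, d - i) else (d - i, d + i).

Lemma sumn_iota_bin (n : nat) : sumn [seq size (iota 0 d.+1) | d <- iota 0 n] = 'C(n.+1, 2).
Proof.
elim: n => // n IHn; rewrite -[n.+1]addn1 iotaD map_cat sumn_cat IHn /= size_iota.
by rewrite addn1 [in RHS]binS bin1; lia.
Qed.

Lemma lattice_triangle_count (A B : nat) : good_pair A B ->
  exists s : seq (nat * nat), [/\ uniq s, size s = 'C((A + B).+1, 2).+1 &
    all (fun x => (x.1 %% 4 == x.2 %% 4) && (A * x.1 + B * x.2 <= 4 * A * B)) s].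
Proof.
(* Exchanging the coordinates exchanges A and B; [fill] is designed for A < B. *)
wlog AB : A B / A < B.
  move=> H gAB; have gBA : good_pair B A.
    case: gAB => h h0 hAB; exists h => //.
    by case: hAB => hAB; [constructor 2|constructor 1|constructor 4|constructor 3]; tauto.
  case: (ltngtP A B) => [ltAB|ltBA|eqAB]; first exact: H; last by case: gAB => h _; case; lia.
  move: ltBA => /H/(_ gBA)[s [us ss /allP hs]]; exists [seq (x.2, x.1) | x <- s]; split.
  - by rewrite map_inj_uniq // => -[a b] [a' b'] [-> ->].
  - by rewrite size_map ss addnC.
  - by apply/allP => _ /mapP[[j k] /hs /= /andP[/eqP e h] ->] /=; rewrite e eqxx /=; nia.
case=> h h0 hAB.
have [r hr] : exists r, (A = h /\ B = h.+1 /\ r = h.*2.+1 /\ A + B = r) \/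
    (A = h.*2.+1 /\ B = h.*2.+3 /\ r = h.+1.*2 /\ A + B = r.*2).
  case: hAB => -[? ?]; subst; try lia; [exists h.*2.+1|exists (h.+1).*2]; lia.
exists ((4 * B, 0) :: [seq fill r d i | d <- iota 0 (A + B), i <- iota 0 d.+1]); split.
- rewrite cons_uniq; apply/andP; split.
    apply/negP => /allpairsPdep[d [i []]]; rewrite !mem_iota /fill => hd hi.
    by case: ifP => c1; [|case: ifP => c2] => -[e1 e2]; case: hr; lia.
  apply: allpairs_uniq_dep; rewrite ?iota_uniq //; first by move=> d _; apply: iota_uniq.
  move=> [d i] [d' i'] /allpairsPdep[a [b [ha hb e]]] /allpairsPdep[a' [b' [ha' hb' e']]].
  move: ha hb ha' hb'; rewrite !mem_iota.
  have [-> ->] : d = a /\ i = b by case: e.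
  have [-> ->] : d' = a' /\ i' = b' by case: e'.
  rewrite /fill /= => ha hb ha' hb' E.
  suff : a = a' /\ b = b' by case=> -> ->.
  move: E; (case: ifP => c1; [|case: ifP => c2]); (case: ifP => c1'; [|case: ifP => c2']);
    by case=> e1 e2; case: hr; lia.
- by rewrite -sumn_iota_bin -(size_allpairs_dep (fill r)).
- apply/andP; split; first by rewrite /= modnMr muln0 addn0 mulnCA mulnA leqnn.
  apply/allP => _ /allpairsPdep[d [i [+ + ->]]]; rewrite !mem_iota /fill.
  move=> hd hi; have {hi} [e de] : exists e, d = i + e by exists (d - i); lia.
  have -> : d - i = e by lia.
  have hd1 : d.+1 <= A + B by lia.
  case: hr => -[? [? [? ?]]]; subst A B r.
    have {}hd1 : d <= h.*2 by lia.
    have := leq_mul (leqnn (h.*2.+1)) hd1; rewrite de in hd1 *.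
    by case: ifP => c1; [|case: ifP => c2]; rewrite /=; nia.
  (* Only the last row d = 2r - 1 contains moved points. *)
  case: (ltnP d (h.+1).*2.*2.-1) => hd2.
    have {}hd1 : d <= 4 * h + 2 by lia.
    have := leq_mul (leqnn (h.+1)) hd1; rewrite de in hd1 hd2 *.
    by case: ifP => c1; [|case: ifP => c2]; rewrite /=; nia.
  have {}hd1 : d = 4 * h + 3 by lia.
  have := congr1 (muln h.+1) hd1; rewrite de in hd1 *.
  by case: ifP => c1; [|case: ifP => c2]; rewrite /=; nia.
Qed.

Local Open Scope classical_set_scope.
Local Open Scope ring_scope.

(** * Global sections *)

Lemma exists_dependency (F : fieldType) (m n : nat) (M : 'I_m -> 'I_n -> F) :
  (n < m)%N -> exists2 l : 'I_m -> F, (exists i, l i != 0) & forall j, \sum_i l i * M i j = 0.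
Proof.
move=> nm; pose A : 'M[F]_(m, n) := \matrix_(i, j) M i j.
have : kermx A != 0.
  rewrite -mxrank_eq0 mxrank_ker subn_eq0 -ltnNge.
  by apply: leq_ltn_trans nm; apply: rank_leq_col.
case/rowV0Pn=> v /sub_kermxP vA v0; exists (fun i => v 0 i).
  by case/rV0Pn: v0 => i vi; exists i.
by move=> j; have := congr1 (fun B : 'rV_n => B 0 j) vA; rewrite !mxE => h;
  rewrite -[RHS]h; apply: eq_bigr => i _; rewrite mxE.
Qed.

Lemma has_dim_le (F : fieldType) (V : lmodType F) (S : set V) (d d' : nat) :
  has_dim S d -> has_dim S d' -> (d <= d')%N.
Proof.
move=> [e [Se free _]] [e' [_ _ span]]; rewrite leqNgt; apply/negP => ltd.
have /choice[M hM] : forall i, exists l : 'I_d' -> F, e i = \sum_j l j *: e' j.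
  by move=> i; apply: span.
have [l [i li] hl] := exists_dependency M ltd.
case/eqP: li; apply: free.
under eq_bigr => k _ do rewrite hM scaler_sumr.
rewrite exchange_big big1 //= => j _.
by under eq_bigr => k _ do rewrite scalerA; rewrite -scaler_suml hl scale0r.
Qed.

Lemma has_dim_unique (F : fieldType) (V : lmodType F) (S : set V) (d d' : nat) :
  has_dim S d -> has_dim S d' -> d = d'.
Proof. by move=> h h1; apply/eqP; rewrite eqn_leq (has_dim_le h h1) (has_dim_le h1 h). Qed.

Definition o0 : 'I_3 := @Ordinal 3 0 isT.
Definition o1 : 'I_3 := @Ordinal 3 1 isT.
Definition o2 : 'I_3 := @Ordinal 3 2 isT.

Lemma big_ord3 (T : Type) (idx : T) (op : Monoid.law idx) (f : 'I_3 -> T) :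
  \big[op/idx]_(i < 3) f i = op (f o0) (op (f o1) (f o2)).
Proof.
rewrite !big_ord_recl big_ord0 Monoid.mulm1.
by congr (op (f _) (op (f _) (f _))); apply: val_inj.
Qed.

Lemma forall_ord3 (P : 'I_3 -> Prop) : P o0 -> P o1 -> P o2 -> forall i, P i.
Proof.
by move=> h0 h1 h2 [[|[|[|//]]] hi]; [move: h0|move: h1|move: h2]; congr P; apply: val_inj.
Qed.

Definition mono3 (x y z : nat) : multinom 3 := Multinom [tuple x; y; z].

Lemma mono3E (u : multinom 3) : u = mono3 (u o0) (u o1) (u o2).
Proof. by apply/mnmP; apply: forall_ord3; rewrite [RHS]multinomE. Qed.

Lemma wdeg3 (a b c : nat) (u : multinom 3) :
  wdeg a b c u = (a * u o0 + (b * u o1 + c * u o2))%N.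
Proof. by rewrite /wdeg big_ord3. Qed.

Definition monomials (a b c n : nat) : seq (multinom 3) :=
  [seq u <- [seq mono3 x.1.1 x.1.2 x.2 |
      x <- allpairs pair (allpairs pair (iota 0 n.+1) (iota 0 n.+1)) (iota 0 n.+1)]
    | wdeg a b c u == n].

Lemma mono3_inj (x y : nat * nat * nat) :
  mono3 x.1.1 x.1.2 x.2 = mono3 y.1.1 y.1.2 y.2 -> x = y.
Proof.
case: x y => [[x0 x1] x2] [[y0 y1] y2] /= e.
have ei i : mono3 x0 x1 x2 i = mono3 y0 y1 y2 i by rewrite e.
by move: (ei o0) (ei o1) (ei o2); rewrite !multinomE !(tnth_nth 0%N) /= => -> -> ->.
Qed.

Lemma monomials_uniq (a b c n : nat) : uniq (monomials a b c n).
Proof.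
apply: filter_uniq; rewrite map_inj_uniq; last exact: mono3_inj.
by do 2?[apply: allpairs_uniq => //; rewrite ?iota_uniq //; last by move=> [? ?] [? ?]].
Qed.

Lemma mem_monomials (a b c n : nat) (u : multinom 3) :
  (0 < a)%N -> (0 < b)%N -> (0 < c)%N -> (u \in monomials a b c n) = (wdeg a b c u == n).
Proof.
move=> a0 b0 c0; rewrite mem_filter; case: eqP => // hu.
rewrite andTb; apply/mapP; exists (u o0, u o1, u o2); last exact: mono3E.
apply: allpairs_f; first apply: allpairs_f; rewrite mem_iota /= add0n -hu wdeg3; nia.
Qed.

Lemma has_dim_sections (F : fieldType) (a b c n : nat) :
  (0 < a)%N -> (0 < b)%N -> (0 < c)%N ->
  has_dim (sections F a b c n) (size (monomials a b c n)).
Proof.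
move=> a0 b0 c0; set s := monomials a b c n.
have mem u : (u \in s) = (wdeg a b c u == n) by apply: mem_monomials.
have us : uniq s by apply: monomials_uniq.
exists (fun i => mpolyX F (nth (mono3 0 0 0) s i)); split.
- move=> i u; rewrite msuppX inE => /eqP ->; apply/eqP; rewrite -mem.
  exact: mem_nth.
- move=> l hl i; have := congr1 (mcoeff (nth (mono3 0 0 0) s i)) hl.
  rewrite raddf_sum mcoeff0 (bigD1 i) //= mcoeffZ mcoeffX eqxx mulr1 big1 ?addr0 //.
  move=> j ji; rewrite mcoeffZ mcoeffX nth_uniq ?ltn_ord //.
  by rewrite (negPf (_ : val j != val i)) ?mulr0.
- move=> f hf; exists (fun i => mcoeff (nth (mono3 0 0 0) s i) f).
  rewrite [LHS]mpolyE.
  rewrite -(big_mkord xpredT (fun i =>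
    mcoeff (nth (mono3 0 0 0) s i) f *: mpolyX F (nth (mono3 0 0 0) s i))).
  rewrite -(big_nth (mono3 0 0 0) xpredT (fun u => mcoeff u f *: mpolyX F u)).
  rewrite [RHS](bigID (fun u => u \in msupp f)) /= [X in _ = _ + X]big1 ?addr0; last first.
    by move=> u /memN_msupp_eq0 ->; rewrite scale0r.
  rewrite -[RHS]big_filter; apply: perm_big; apply: uniq_perm; [exact: msupp_uniq|exact: filter_uniq us|].
  by move=> u; rewrite mem_filter mem; case: (boolP (u \in _)) => //= /hf ->; rewrite eqxx.
Qed.

Lemma h0_eq (F : fieldType) (a b c n : nat) :
  (0 < a)%N -> (0 < b)%N -> (0 < c)%N -> h0 F a b c n = size (monomials a b c n).
Proof.
move=> a0 b0 c0; have hd := has_dim_sections F n a0 b0 c0.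
apply: (has_dim_unique (S := sections F a b c n)) => //.
by rewrite /h0; apply: (xgetPex 0%N); exists (size (monomials a b c n)).
Qed.

(** * Sections vanishing at a point of the torus *)

Lemma mcoeff_translateX (F : fieldType) (Q : 'I_3 -> F) (u t : multinom 3) :
  mcoeff t (translate Q (mpolyX F u)) = \prod_(i < 3) ('C(u i, t i)%:R * Q i ^+ (u i - t i)).
Proof.
rewrite /translate comp_mpolyX.
(* A common bound on all exponents gives the three binomial expansions one index type; the terms
   added have zero binomial coefficient. *)
pose N := (\max_(i < 3) maxn (u i) (t i))%N.
have uN i : (u i <= N)%N by apply: leq_trans (leq_bigmax i); apply: leq_maxl.
have tN i : (t i < N.+1)%N by rewrite ltnS; apply: leq_trans (leq_bigmax i); apply: leq_maxr.
have expand (i : 'I_3) : tnth [tuple mpolyX F (mnm1 i) + mpolyC 3 (Q i) | i < 3] i ^+ u i =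
   \sum_(k < N.+1) ('C(u i, k)%:R * Q i ^+ (u i - k)) *: mpolyX F (mnm_muln (mnm1 i) k).
  rewrite tnth_mktuple addrC exprDn.
  rewrite (big_ord_widen N.+1 (fun k =>
    (mpolyC 3 (Q i) ^+ (u i - k) * mpolyX F (mnm1 i) ^+ k) *+ 'C(u i, k))) ?ltnS ?uN //.
  rewrite big_mkcond; apply: eq_bigr => k _; case: ltnP => hk.
    by rewrite mpolyXn -rmorphXn mul_mpolyC -scaler_nat scalerA.
  by rewrite bin_small // mul0r scale0r.
under eq_bigr => i _ do rewrite expand.
rewrite bigA_distr_bigA raddf_sum /=.
have prodE (g : {ffun 'I_3 -> 'I_N.+1}) :
    \prod_(i < 3) (('C(u i, g i)%:R * Q i ^+ (u i - g i)) *: mpolyX F (mnm_muln (mnm1 i) (g i))) =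
    (\prod_(i < 3) ('C(u i, g i)%:R * Q i ^+ (u i - g i)))
      *: mpolyX F (@Multinom 3 [tuple (g i : nat) | i < 3]).
  rewrite scaler_prod; congr (_ *: _); rewrite mpolyXE_id.
  by apply: eq_bigr => i _; rewrite mnmE mpolyXn.
under eq_bigr => g _ do rewrite prodE mcoeffZ mcoeffX.
rewrite (bigD1 [ffun i => Ordinal (tN i)]) //= [X in _ + X]big1 ?addr0.
  rewrite (_ : _ == t); last by apply/eqP/mnmP => i; rewrite mnmE ffunE.
  by rewrite mulr1; apply: eq_bigr => i _; rewrite ffunE.
move=> g gt; case: eqP => [e|_]; last by rewrite mulr0.
case/eqP: gt; apply/ffunP => i; rewrite ffunE; apply: val_inj => /=.
by rewrite -e mnmE.
Qed.

(** * Polynomial maps on abelian groups *)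

Section Polynomial_maps.
Variable F : fieldType.

(** Degree at most [e] means that any e + 1 successive differences vanish. No division occurs, so
    this works in every characteristic. *)
Fixpoint deg_le (V : zmodType) (e : nat) (h : V -> F) : Prop :=
  if e is e'.+1 then forall v, deg_le e' (fun x => h (x + v) - h x)
  else forall v x, h (x + v) = h x.

Variable V : zmodType.
Implicit Types (h : V -> F) (e : nat).

Lemma deg_leS e h : deg_le e h -> deg_le e.+1 h.
Proof.
elim: e h => [|e IHe] h /= hh v; last by apply: IHe.
by move=> w x; rewrite !hh !subrr.
Qed.

Lemma deg_leW e e' h : (e <= e')%N -> deg_le e h -> deg_le e' h.
Proof. by move=> /subnK <-; elim: (e' - e)%N => // n IHn /IHn; apply: deg_leS. Qed.

Lemma deg_le0 e : deg_le e (fun _ : V => 0).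
Proof. by apply: (@deg_leW 0). Qed.

Lemma deg_leD e h h' : deg_le e h -> deg_le e h' -> deg_le e (fun x => h x + h' x).
Proof.
elim: e h h' => [|e IHe] h h' /= hh hh' v; first by move=> x; rewrite hh hh'.
rewrite (_ : (fun x => _) = fun x => (h (x + v) - h x) + (h' (x + v) - h' x)); first exact: IHe.
by apply/funext => x; rewrite opprD addrACA.
Qed.

Lemma deg_leN e h : deg_le e h -> deg_le e (fun x => - h x).
Proof.
elim: e h => [|e IHe] h /= hh v; first by move=> x; rewrite hh.
rewrite (_ : (fun x => _) = fun x => - (h (x + v) - h x)); first exact: IHe.
by apply/funext => x; rewrite opprD.
Qed.

Lemma deg_le_affine (U : zmodType) e (h : U -> F) (phi : V -> U) :
  (forall x v, phi (x + v) = phi x + (phi v - phi 0)) -> deg_le e h -> deg_le e (h \o phi).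
Proof.
move=> aff; elim: e h => [|e IHe] h /= hh v; first by move=> x; rewrite aff hh.
rewrite (_ : (fun x => _) = (fun x => h (x + (phi v - phi 0)) - h x) \o phi); first exact: IHe.
by apply/funext => x /=; rewrite aff.
Qed.

Lemma deg_le_shift e h w : deg_le e h -> deg_le e (fun x => h (x + w)).
Proof.
by move=> hh; apply: (@deg_le_affine V e h (fun x => x + w)) => // x v; rewrite add0r addrK addrAC.
Qed.

(** Induction on the sum of the degrees, by the Leibniz rule for differences with one factor
    shifted. *)
Lemma deg_leM e e' h h' : deg_le e h -> deg_le e' h' -> deg_le (e + e') (fun x => h x * h' x).
Proof.
move: {2}(e + e')%N (leqnn (e + e')%N) => n; elim: n e e' h h' => [|n IHn] e e' h h' en hh hh'.
  move: en hh hh'; rewrite leqn0 addn_eq0 => /andP[/eqP -> /eqP ->] /= hh hh' v x.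
  by rewrite hh hh'.
(* If both degrees are 0 the predecessor is truncated, and the product is seen directly to be
   constant. *)
suff H v : deg_le (e + e').-1 (fun x => h (x + v) * h' (x + v) - h x * h' x).
  case E: (e + e')%N => [|m]; last by move=> v; have := H v; rewrite E.
  move/eqP: E; rewrite addn_eq0 => /andP[/eqP e0 /eqP e0']; subst.
  by move: hh hh' => /= hh hh' v x; rewrite hh hh'.
rewrite (_ : (fun x => _) =
  fun x => (h (x + v) - h x) * h' (x + v) + h x * (h' (x + v) - h' x)); last first.
  by apply/funext => x; rewrite mulrBl mulrBr addrA subrK.
apply: deg_leD.
  case: e en hh => [|e] en hh.
    rewrite (_ : (fun x => _) = fun=> 0); first exact: deg_le0.
    by apply/funext => x; rewrite hh subrr mul0r.
  by apply: IHn => //; apply: deg_le_shift.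
case: e' en hh' => [|e'] en hh'.
  rewrite (_ : (fun x => _) = fun=> 0); first exact: deg_le0.
  by apply/funext => x; rewrite hh' subrr mulr0.
by rewrite addnS /=; apply: IHn => //; rewrite -ltnS -addnS.
Qed.

End Polynomial_maps.

(** * Binomial coefficients of integers and Newton interpolation *)

Section Binomials.
Variable F : fieldType.

(** This is the binomial coefficient of z over t for any integer z; since [Negz m] is -(m + 1), the
    second branch is the reflection formula. *)
Definition binz (t : nat) (z : int) : F :=
  match z with Posz m => 'C(m, t)%:R | Negz m => (-1) ^+ t * 'C(m + t, t)%:R end.

Lemma binzS (t : nat) (z : int) : binz t.+1 (z + 1) = binz t.+1 z + binz t z.
Proof.
case: z => [m|[|m]].
- by rewrite -PoszD addn1 /= binS natrD.
- by rewrite NegzE addNr /= !add0n !binn bin0n exprS mulN1r mulNr addNr.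
- have -> : Negz m.+1 + 1 = Negz m by rewrite !NegzE; lia.
  rewrite /= !addnS !addSn (binS (m + t).+1) exprS natrD; ring.
Qed.

(** By Pascal's rule the unit difference of [binz t.+1] is [binz t]; the difference by any integer
    is, up to sign, a sum of shifts of it. *)
Lemma binz_deg (t : nat) : deg_le t (binz t).
Proof.
elim: t => [|t IHt] /=.
  have one z : binz 0 z = 1 by case: z => m /=; rewrite ?bin0 ?mulr1.
  by move=> v x; rewrite !one.
have d1 (z : int) : binz t.+1 (z + 1) - binz t.+1 z = binz t z by rewrite binzS addrC addKr.
elim/int_rec => [|n IHn|n IHn].
- rewrite (_ : (fun x => _) = fun=> 0); first exact: deg_le0.
  by apply/funext => x; rewrite addr0 subrr.
- rewrite (_ : (fun x => _) = fun x : int => binz t (x + n%:Z) + (binz t.+1 (x + n) - binz t.+1 x)).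
    by apply: deg_leD IHn; apply: deg_le_shift.
  by apply/funext => x; rewrite -d1 intS (addrC 1) !addrA subrK.
- rewrite (_ : (fun x => _) = fun x : int =>
    - binz t (x - n.+1%:Z) + (binz t.+1 (x - n%:Z) - binz t.+1 x)).
    by apply: deg_leD IHn; apply: deg_leN; apply: deg_le_shift.
  apply/funext => x; rewrite -d1.
  have -> : x - n.+1%:Z + 1 = x - n%:Z by lia.
  by rewrite opprB addrA subrK.
Qed.

(** Combinations are built term by term, so that a linear relation satisfied by all products of
    binomials extends to them by induction. *)
Inductive bin_span (e : nat) : (nat -> nat -> F) -> Prop :=
| bin_span0 : bin_span e (fun _ _ => 0)
| bin_spanD h c i j : (i + j <= e)%N -> bin_span e h ->
    bin_span e (fun x y => h x y + c * 'C(x, i)%:R * 'C(y, j)%:R).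

Lemma bin_span_add e h h' : bin_span e h -> bin_span e h' -> bin_span e (fun x y => h x y + h' x y).
Proof.
move=> hh; elim=> [|g c i j ij _ IH].
  by rewrite (_ : (fun x => _) = h) //; apply/funext => x; apply/funext => y; rewrite addr0.
rewrite (_ : (fun x => _) = fun x y => (h x y + g x y) + c * 'C(x, i)%:R * 'C(y, j)%:R).
  exact: bin_spanD.
by apply/funext => x; apply/funext => y; rewrite addrA.
Qed.

Lemma sum_bin (n i : nat) : (\sum_(k < n) 'C(k, i) = 'C(n, i.+1))%N.
Proof. by elim: n => [|n IHn]; rewrite ?big_ord0 // big_ord_recr /= IHn binS. Qed.

(** Summation raises the degree by one through the hockey-stick identity [sum_bin]. *)
Lemma bin_span_sum e h : bin_span e h -> bin_span e.+1 (fun x y => \sum_(k < x) h k y).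
Proof.
elim=> [|g c i j ij _ IH].
  rewrite (_ : (fun x => _) = fun _ _ => 0); first exact: bin_span0.
  by apply/funext => x; apply/funext => y; rewrite big1.
rewrite (_ : (fun x => _) = fun x y => \sum_(k < x) g k y + c * 'C(x, i.+1)%:R * 'C(y, j)%:R).
  exact: bin_spanD.
apply/funext => x; apply/funext => y; rewrite big_split /=; congr (_ + _).
by rewrite -mulr_suml -mulr_sumr -natr_sum sum_bin.
Qed.

Lemma bin_span_sum0 e h : bin_span e h -> bin_span e.+1 (fun _ y => \sum_(k < y) h 0%N k).
Proof.
elim=> [|g c i j ij _ IH].
  rewrite (_ : (fun x => _) = fun _ _ => 0); first exact: bin_span0.
  by apply/funext => x; apply/funext => y; rewrite big1.
rewrite (_ : (fun x => _) = fun x y =>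
    \sum_(k < y) g 0%N k + (c * 'C(0, i)%:R) * 'C(x, 0)%:R * 'C(y, j.+1)%:R).
  by apply: (@bin_spanD e.+1 (fun _ y => \sum_(k < y) g 0%N k)) => //; lia.
apply/funext => x; apply/funext => y; rewrite big_split /=; congr (_ + _).
by rewrite -mulr_sumr -natr_sum sum_bin bin0 mulr1.
Qed.

(* Newton interpolation: sum the differences in the first direction, then, along the axis, in the second. *)
Lemma deg_le_bin_span (e : nat) (h : int * int -> F) :
  deg_le e h -> bin_span e (fun x y : nat => h (x%:Z, y%:Z)).
Proof.
elim: e h => [|e IHe] h hh.
  have := bin_spanD (h (0, 0)) (isT : (0 + 0 <= 0)%N) (bin_span0 0).
  congr bin_span; apply/funext => x; apply/funext => y.
  by rewrite add0r !bin0 !mulr1 -(hh (x%:Z, y%:Z) (0, 0)) /= -[_ + _]/(0 + x%:Z, 0 + y%:Z) !add0r.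
have := bin_span_sum (IHe _ (hh (1, 0))); have := bin_span_sum0 (IHe _ (hh (0, 1))).
move=> h1 /(bin_span_add h1) h2.
have := bin_span_add h2 (bin_spanD (h (0, 0)) (leq0n e.+1 : (0 + 0 <= e.+1)%N) (bin_span0 e.+1)).
congr bin_span; apply/funext => x; apply/funext => y.
rewrite add0r !bin0 !mulr1.
have tel (f : nat -> F) n : \sum_(k < n) (f k.+1 - f k) = f n - f 0%N.
  by rewrite -(big_mkord xpredT (fun k => f k.+1 - f k)) telescope_sumr.
have e1 : \sum_(k < x) (h ((k%:Z, y%:Z) + (1, 0)) - h (k%:Z, y%:Z)) = h (x%:Z, y%:Z) - h (0, y%:Z).
  rewrite -(tel (fun k => h (k%:Z, y%:Z))); apply: eq_bigr => k _.
  by rewrite -[_ + (1, 0)]/(k%:Z + 1, y%:Z + 0) addr0 -PoszD addn1.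
have e2 : \sum_(k < y) (h ((0, k%:Z) + (0, 1)) - h (0, k%:Z)) = h (0, y%:Z) - h (0, 0).
  rewrite -(tel (fun k => h (0, k%:Z))); apply: eq_bigr => k _.
  by rewrite -[_ + (0, 1)]/(0 + 0, k%:Z + 1) addr0 -PoszD addn1.
by rewrite e1 e2 addrAC subrK addrC subrK.
Qed.

End Binomials.

(** Modulo 4, c is 3b, so D is b(j + 3k) with b invertible. *)
Lemma wdeg_mod4 (b c P D : nat) (u : multinom 3) :
  coprime 4 b -> (c + 4 * P = 3 * b)%N -> (4 %| D)%N -> wdeg 4 b c u = D ->
  (u o1 %% 4 == u o2 %% 4)%N.
Proof.
move=> cop hP hD; rewrite wdeg3 => hu.
have : (4 %| b * (u o1 + 3 * u o2))%N.
  have -> : (b * (u o1 + 3 * u o2) = b * u o1 + c * u o2 + 4 * (P * u o2))%N by nia.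
  rewrite dvdn_addl ?dvdn_mulr // -(@dvdn_addr (4 * u o0)) ?dvdn_mulr //.
  by rewrite hu.
by rewrite Gauss_dvdr //; lia.
Qed.

Lemma exists_vanishing_section (F : fieldType) (Q : 'I_3 -> F) (b c P D n : nat) :
  (0 < b)%N -> (0 < c)%N -> coprime 4 b -> (c + 4 * P = 3 * b)%N -> (4 %| D)%N ->
  (forall i, Q i != 0) -> ('C(n.+1, 2) < h0 F 4 b c D)%N ->
  exists f, [/\ f != 0, sections F 4 b c D f & vanishes_to Q n%:Z f].
Proof.
move=> b0 c0 cop hP hD hQ; rewrite h0_eq // => hn.
set s := monomials 4 b c D in hn.
have mem u : (u \in s) = (wdeg 4 b c u == D) by apply: mem_monomials.
have us : uniq s by apply: monomials_uniq.
pose x (i : 'I_(size s)) := nth (mono3 0 0 0) s i.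
have xs i : wdeg 4 b c (x i) = D by apply/eqP; rewrite -mem mem_nth.
(* Integer coordinates on the monomials: the exponents of z, y, x are al, 4 be - 3 al and D / 4 + P
   al - b be. *)
pose al i := x i o2; pose be i := ((x i o1 + 3 * x i o2) %/ 4)%N.
(* The pairs of total degree below n, one for each linear condition. *)
pose C := [seq (i, (a - i)%N) | a <- iota 0 n, i <- iota 0 a.+1].
have sC : size C = 'C(n.+1, 2).
  by rewrite -sumn_iota_bin -(size_allpairs_dep (fun a i => (i, (a - i)%N))).
pose M i (j : 'I_(size C)) : F :=
  'C(al i, (nth (0, 0)%N C j).1)%:R * 'C(be i, (nth (0, 0)%N C j).2)%:R.
have [l [i0 li0] hl] : exists2 l : 'I_(size s) -> F, (exists i, l i != 0) &
    forall j, \sum_i l i * M i j = 0.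
  by apply: exists_dependency; rewrite sC.
have kill e h : (e < n)%N -> bin_span e h -> \sum_i l i * h (al i) (be i) = 0.
  move=> en; elim=> [|g k i j ij _ IH]; first by rewrite big1 // => i _; rewrite mulr0.
  under eq_bigr => ? _ do rewrite mulrDr.
  rewrite big_split /= IH add0r.
  have hC : (i, j) \in C.
    apply/allpairsPdep; exists (i + j)%N, i; rewrite !mem_iota; split; [lia|lia|].
    by congr (_, _); lia.
  have := hl (Ordinal (introT idP (etrans (index_mem _ _) hC) : (index (i, j) C < size C)%N)).
  rewrite /M /= nth_index //= => /(congr1 ( *%R k)); rewrite mulr0 mulr_sumr => hk.
  by rewrite -[RHS]hk; apply: eq_bigr => ? _; ring.
(* Dividing each coefficient by the value of its monomial at Q removes Q from the Taylor
   coefficients, up to the common factor [(Qm t)^-1]; this uses that the point is in the torus. *)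
pose Qm (u : multinom 3) := \prod_(k < 3) Q k ^+ u k.
have Qm0 u : Qm u != 0 by apply/prodf_neq0 => k _; rewrite expf_neq0.
pose f := \sum_i (l i / Qm (x i)) *: mpolyX F (x i).
have fE u : mcoeff u f = \sum_i (l i / Qm (x i)) * (x i == u)%:R.
  by rewrite raddf_sum /=; apply: eq_bigr => i _; rewrite mcoeffZ mcoeffX.
exists f; split.
- apply/eqP => f0; have := fE (x i0); rewrite f0 mcoeff0 (bigD1 i0) //= eqxx mulr1 big1 ?addr0.
    by move/esym/eqP; rewrite mulf_eq0 invr_eq0 (negPf li0) (negPf (Qm0 _)).
  by move=> i ii0; rewrite nth_uniq // (negPf (_ : val i != val i0)) ?mulr0.
- move=> u; rewrite mcoeff_msupp; apply: contraNeq => hu; rewrite fE big1 // => i _.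
  by case: eqP => [ei|]; rewrite ?mulr0 //; case/eqP: hu; rewrite -ei.
move=> t ht; rewrite /translate (big_morph _ (comp_mpolyD _) (comp_mpoly0 _)) raddf_sum /=.
have tn : (t o0 + (t o1 + t o2) < n)%N by move: ht; rewrite mdegE big_ord3.
(* The product of the binomials of the three exponents over t, as a function of (al, be); its degree
   is at most |t| < n. *)
pose h (z : int * int) : F :=
  binz F (t o0) ((D %/ 4)%N%:Z + P%:Z * z.1 - b%:Z * z.2) *
  (binz F (t o1) (4 * z.2 - 3 * z.1) * binz F (t o2) z.1).
have hdeg : deg_le (t o0 + (t o1 + t o2)) h.
  apply: deg_leM; [|apply: deg_leM].
  - apply: (@deg_le_affine F _ _ _ (binz F (t o0))
      (fun z : int * int => (D %/ 4)%N%:Z + P%:Z * z.1 - b%:Z * z.2)).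
      by move=> [z1 z2] [w1 w2]; rewrite /=; lia.
    exact: binz_deg.
  - apply: (@deg_le_affine F _ _ _ (binz F (t o1)) (fun z : int * int => 4 * z.2 - 3 * z.1)).
      by move=> [z1 z2] [w1 w2]; rewrite /=; lia.
    exact: binz_deg.
  - apply: (@deg_le_affine F _ _ _ (binz F (t o2)) (fun z : int * int => z.1)).
      by move=> [z1 z2] [w1 w2]; rewrite /=; lia.
    exact: binz_deg.
have := kill _ _ tn (deg_le_bin_span hdeg).
have hh i : h ((al i)%:Z, (be i)%:Z) = \prod_(k < 3) 'C(x i k, t k)%:R.
  rewrite big_ord3 /h /=.
  have m4 := wdeg_mod4 cop hP hD (xs i).
  have bE : (4 * be i = x i o1 + 3 * x i o2)%N by rewrite /be; lia.
  have -> : 4 * (be i)%:Z - 3 * (al i)%:Z = (x i o1)%:Z by rewrite /al; lia.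
  have -> : (D %/ 4)%N%:Z + P%:Z * (al i)%:Z - b%:Z * (be i)%:Z = (x i o0)%:Z.
    case/dvdnP: hD xs => w -> xs; have := xs i; rewrite wdeg3 mulnK // /al; nia.
  by [].
move/(congr1 ( *%R (Qm t)^-1)); rewrite mulr0 mulr_sumr => kh; rewrite -[RHS]kh; apply: eq_bigr => i _.
rewrite comp_mpolyZ mcoeffZ -/(translate Q _) mcoeff_translateX hh.
suff -> : \prod_(k < 3) ('C(x i k, t k)%:R * Q k ^+ (x i k - t k)) =
    Qm (x i) * (Qm t)^-1 * \prod_(k < 3) 'C(x i k, t k)%:R.
  by move: (\prod_(k < 3) _) => p; field; rewrite !Qm0.
rewrite /Qm -prodfV -!big_split /=; apply: eq_bigr => k _.
case: (leqP (t k) (x i k)) => tk; last by rewrite bin_small // mul0r mulr0.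
by rewrite expfB_cond ?(negPf (hQ k)) ?add0n // mulrC.
Qed.

(** * The expected threshold *)

Definition triangle (b c D : nat) (x : nat * nat) : bool :=
  ((x.1 %% 4 == x.2 %% 4) && (b * x.1 + c * x.2 <= D))%N.

Lemma triangle_swap (b c D m : nat) : at_most (triangle b c D) m -> at_most (triangle c b D) m.
Proof.
apply: (at_most_map (f := fun x => (x.2, x.1))).
  by move=> [j k] /andP[/= /eqP e h]; rewrite /triangle /= e eqxx addnC.
by move=> [j k] [j' k'] _ _ [-> ->].
Qed.

Section Weights.
Variables (F : fieldType) (b c P : nat).
Hypotheses (b0 : (0 < b)%N) (c0 : (0 < c)%N) (cop : coprime 4 b) (hP : (c + 4 * P = 3 * b)%N).

(** The exponents of y and z determine that of x, so monomials inject into the triangle. *)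
Lemma h0_le (D m : nat) : (4 %| D)%N -> at_most (triangle b c D) m -> (h0 F 4 b c D <= m)%N.
Proof.
move=> hD hm; rewrite h0_eq //.
have hu u : u \in monomials 4 b c D -> wdeg 4 b c u = D by rewrite mem_monomials // => /eqP.
rewrite -(size_map (fun u : multinom 3 => (u o1, u o2))); apply: hm.
  rewrite map_inj_in_uniq ?monomials_uniq // => u v /hu + /hu + [e1 e2].
  rewrite !wdeg3 => eu ev; rewrite (mono3E u) (mono3E v) e1 e2; congr mono3.
  by move: eu ev; rewrite e1 e2; lia.
apply/allP => _ /mapP[u /hu uD ->]; rewrite /triangle /= (wdeg_mod4 cop hP hD uD) /=.
by rewrite -uD wdeg3 leq_addl.
Qed.

(** Conversely D - bj - ck is divisible by 4 because b + c = 4(b - P), which gives the exponent of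
    x. *)
Lemma h0_ge (D : nat) (s : seq (nat * nat)) : (4 %| D)%N ->
  uniq s -> all (triangle b c D) s -> (size s <= h0 F 4 b c D)%N.
Proof.
move=> hD us /allP hs; rewrite h0_eq //.
rewrite -(size_map (fun x : nat * nat => mono3 ((D - (b * x.1 + c * x.2)) %/ 4) x.1 x.2)).
apply: uniq_leq_size.
  rewrite map_inj_uniq // => -[j k] [j' k'] e.
  by have := @mono3_inj (_, _, _) (_, _, _) e; case=> _ -> ->.
move=> _ /mapP[[j k] /hs /andP[/= jk h] ->]; rewrite mem_monomials //.
rewrite wdeg3 !multinomE !(tnth_nth 0%N) /= mulnC divnK ?subnK //.
rewrite dvdn_sub // level_dvd4 //.
by have -> : (b + c = 4 * (b - P))%N by [lia]; apply: dvdn_mulr.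
Qed.

Lemma nu_ge (D d : nat) : (0 < d)%N -> ('C(d.+1, 2) < h0 F 4 b c D)%N -> (d <= nu F 4 b c D)%N.
Proof.
move=> d0 hd; have dh : (d < h0 F 4 b c D)%N.
  by apply: leq_ltn_trans hd; rewrite binS bin1 leq_addl.
by apply: (@leq_bigmax_cond _ _ _ (Ordinal dh)); rewrite /= d0.
Qed.

Lemma nu_h0 (D : nat) : (0 < nu F 4 b c D)%N -> ('C((nu F 4 b c D).+1, 2) < h0 F 4 b c D)%N.
Proof.
rewrite /nu; elim/big_ind: _ => // [x y|i /andP[]] //.
by rewrite /maxn; case: ifP.
Qed.

(** Hence the congruence of [wdeg_mod4] is available for every class in the supremum. *)
Lemma class_mH_dvd4 (R : realType) (m : R) (D : nat) :
  multiples b c m -> class_mH 4 b c m D -> (4 %| D)%N.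
Proof.
move=> [n n0 hm] hD.
have [->|->] : D = (4 * (c * n))%N \/ D = (4 * (b * n))%N; rewrite ?dvdn_mulr //.
case: hm => hm; [left|right]; apply/eqP; rewrite -(@eqr_nat R) hD hm !natrM; apply/eqP.
  by field; rewrite pnatr_eq0 -lt0n.
by field; rewrite pnatr_eq0 -lt0n.
Qed.

Variables (A B beta gamma : nat).
Hypotheses (gAB : good_pair A B) (hbg : (beta = b /\ gamma = c) \/ (beta = c /\ gamma = b)).
Hypotheses (hB : (B * beta <= A * gamma)%N) (hA : (4 * A ^ 2 * gamma <= (A + B) ^ 2 * beta)%N).

Lemma triangle_bg (D m : nat) : at_most (triangle beta gamma D) m <-> at_most (triangle b c D) m.
Proof. by case: hbg => -[-> ->] //; split=> /triangle_swap. Qed.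

(** Otherwise [triangle_count_le] with d = nu(D) contradicts [nu_h0]. For m_0 = A / beta and d0 = A
    + B, [hA] reads m_0^2 4bc <= d0^2. *)
Lemma nu_le (D : nat) : (4 %| D)%N -> (4 * gamma * A * nu F 4 b c D <= (A + B) * D)%N.
Proof.
move=> hD; rewrite leqNgt; apply/negP => lt.
have nu0 : (0 < nu F 4 b c D)%N by move: lt; case: nu => //; rewrite muln0.
have := nu_h0 nu0; rewrite ltnNge => /negP; apply; apply: h0_le => //.
by apply/triangle_bg; apply: (triangle_count_le gAB hB hA lt).
Qed.

Lemma nu_lattice_triangle : nu F 4 b c (4 * gamma * A) = (A + B)%N.
Proof.
have [A0 B0] : (0 < A /\ 0 < B)%N by case: gAB => h hh; case; lia.
have g0 : (0 < gamma)%N by case: hbg => -[_ ->].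
apply/eqP; rewrite eqn_leq; apply/andP; split.
  rewrite -(@leq_pmul2l (4 * gamma * A)) ?muln_gt0 ?g0 //.
  by rewrite [X in (_ <= X)%N]mulnC nu_le // -mulnA dvdn_mulr.
apply: nu_ge; first by rewrite addn_gt0 A0.
have [s [us <- hs]] := lattice_triangle_count gAB.
(* By [hB], B(beta j + gamma k) <= gamma(Aj + Bk), so the lattice triangle lies in that of D_0. *)
have {}hs : all (triangle beta gamma (4 * gamma * A)) s.
  apply/sub_all: hs => -[j k] /andP[/= jk h]; rewrite /triangle /= jk /=.
  rewrite -(@leq_pmul2l B) //; have := leq_mul hB (leqnn j); have := leq_mul h (leqnn gamma); nia.
have dv : (4 %| 4 * gamma * A)%N by rewrite -mulnA dvdn_mulr.
case: hbg => -[eb eg]; first by subst; apply: h0_ge.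
rewrite -(size_map (fun x => (x.2, x.1))); apply: h0_ge => //.
  by rewrite map_inj_uniq // => -[j k] [j' k'] [-> ->].
rewrite all_map; apply/sub_all: hs => -[j k] /andP[/= /eqP jk h].
by subst; rewrite /= /triangle /= jk eqxx addnC.
Qed.

Lemma computed_by_pair (R : realType) :
  computed_by F 4 b c (A%:R / beta%:R : R) (A + B).
Proof.
have [A0 B0] : (0 < A /\ 0 < B)%N by case: gAB => h hh; case; lia.
have g0 : (0 < gamma)%N by case: hbg => -[_ ->].
have be0 : (0 < beta)%N by case: hbg => -[->].
have bgE : (b * c = beta * gamma)%N by case: hbg => -[-> ->] //; rewrite mulnC.
have cls : class_mH 4 b c (A%:R / beta%:R : R) (4 * gamma * A).
  rewrite /class_mH -(mulnA 4%N b) bgE !natrM; field; rewrite pnatr_eq0; lia.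
exists (4 * gamma * A)%N; split=> //; first exact: nu_lattice_triangle.
rewrite nu_lattice_triangle; apply/eqP; rewrite eq_le; apply/andP; split; last first.
  apply: ereal_sup_ubound; exists (A%:R / beta%:R), (4 * gamma * A)%N; split=> //.
    by case: hbg => -[-> _]; exists A => //; [left|right].
  by rewrite nu_lattice_triangle.
apply: ge_ereal_sup => _ [m [D [hm hD ->]]]; rewrite lee_fin.
have D4 := class_mH_dvd4 hm hD.
case: hm => n n0 hm.
have m0 : 0 < m by case: hm => ->; rewrite divr_gt0 ?ltr0n.
rewrite ler_pdivrMr //.
have := nu_le D4; rewrite -(@ler_nat R) [X in _ <= X]natrM hD.
rewrite -(mulnA 4%N b) bgE !natrM => h.
have k0 : 0 < (4 * gamma%:R * A%:R : R) by rewrite !mulr_gt0 ?ltr0n.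
rewrite -(ler_pM2l k0); apply: le_trans h _; rewrite le_eqVlt; apply/orP; left; apply/eqP.
field; rewrite !pnatr_eq0; lia.
Qed.

End Weights.

(** * The lower bound for the threshold *)

Section Threshold.
Variables (R : realType) (F : fieldType) (Q : 'I_3 -> F) (b c P : nat).
Hypotheses (b0 : (0 < b)%N) (c0 : (0 < c)%N) (cop : coprime 4 b) (hP : (c + 4 * P = 3 * b)%N).
Hypothesis hQ : forall i, Q i != 0.

(** A section vanishing to order nu(D) makes mH - nu(D)E effective; divide by m. *)
Lemma nu_le_gamma_Q (m : R) (D : nat) : 0 < m -> class_mH 4 b c m D -> (4 %| D)%N ->
  (0 < nu F 4 b c D)%N -> (((nu F 4 b c D)%:R / m)%:E <= gamma_Q 4 b c Q (1 : R))%E.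
Proof.
move=> m0 hD D4 nu0; apply: ereal_sup_ubound; exists ((nu F 4 b c D)%:R / m) => //.
split; first by rewrite divr_gt0 ?ltr0n.
apply: subset_closure.
have [f [f0 fs fv]] := exists_vanishing_section b0 c0 cop hP D4 hQ (nu_h0 nu0).
exists 1%N, (fun _ => m^-1), (fun _ => (D%:R / (4 * b * c)%:R, - (nu F 4 b c D)%:Z%:~R)); split.
- by move=> _; rewrite invr_ge0 ltW.
- by move=> _; exists D, f, (nu F 4 b c D).
rewrite !big_ord1 /=; congr (_, _).
  rewrite hD !natrM; field; rewrite !pnatr_eq0 (gt_eqF m0) /=; lia.
by rewrite pmulrn mulrN mulrC.
Qed.

Lemma gamma_expected_le_gamma_Q : (gamma_expected R F 4 b c <= gamma_Q 4 b c Q (1 : R))%E.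
Proof.
apply: ge_ereal_sup => _ [m [D [hm hD ->]]].
have m0 : 0 < m by case: hm => n n0 [] ->; rewrite divr_gt0 ?ltr0n.
have D4 := class_mH_dvd4 b0 c0 hm hD.
have [nu0|nu0] := posnP (nu F 4 b c D); last exact: nu_le_gamma_Q.
rewrite nu0 mul0r.
(* When nu is 0 it remains to see that the supremum defining [gamma_Q], over positive reals, is not
   over the empty set; degree 4b, with the sections x^b and y^4, provides an element. *)
have c1 : class_mH 4 b c (c%:R^-1 : R) (4 * b).
  by rewrite /class_mH !natrM; field; rewrite pnatr_eq0; lia.
have d4 : (4 %| 4 * b)%N by apply: dvdn_mulr.
have nu1 : (0 < nu F 4 b c (4 * b))%N.
  apply: nu_ge => //.
  apply: (@h0_ge F b c P b0 c0 cop hP _ [:: (0, 0); (4, 0)]%N) => //.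
  by rewrite /= /triangle /= !muln0 !addn0 leq0n mulnC leqnn.
apply: le_trans (nu_le_gamma_Q _ c1 d4 nu1); last by rewrite invr_gt0 ltr0n.
by rewrite lee_fin divr_ge0 ?ler0n // invr_ge0 ler0n.
Qed.

End Threshold.

(** * The subdivision of the interval *)

Section Intervals.
Variable R : realType.

Lemma I_end_denom_gt0 (k : nat) : (0 < k)%N -> 0 < 8 * k%:R ^+ 2 - 4 * k%:R - 1 :> R.
Proof. by move=> k0; have : (1 : R) <= k%:R by [rewrite ler1n]; nra. Qed.

Lemma I_mid_denom_gt0 (k : nat) : (0 < k)%N -> 0 < 8 * k%:R ^+ 2 + 4 * k%:R - 1 :> R.
Proof. by move=> k0; have : (1 : R) <= k%:R by [rewrite ler1n]; nra. Qed.

Lemma I_breaks (k : nat) : (0 < k)%N ->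
  [/\ I_end R k.+1 <= (2 * k%:R + 1) / k%:R, (2 * k%:R + 1) / k%:R <= I_mid R k,
      I_mid R k <= 4 * k%:R / (2 * k%:R - 1) & 4 * k%:R / (2 * k%:R - 1) <= I_end R k].
Proof.
move=> k0; have k1 : (1 : R) <= k%:R by rewrite ler1n.
have d1 := I_end_denom_gt0 k0; have d2 := I_mid_denom_gt0 k0.
have d3 := @I_end_denom_gt0 k.+1 isT.
rewrite /I_end /I_mid; split.
- rewrite ler_pdivrMr // mulrAC ler_pdivlMr; last by lra.
  by rewrite -[k.+1%:R]natr1; nra.
- rewrite ler_pdivrMr; last by lra.
  rewrite mulrAC ler_pdivlMr //; nra.
- rewrite ler_pdivrMr // mulrAC ler_pdivlMr; last by lra.
  nra.
- rewrite ler_pdivrMr; last by lra.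
  rewrite mulrAC ler_pdivlMr //; nra.
Qed.

Lemma I_split (k : nat) : (0 < k)%N ->
  I_ R k = I'_minus R k `|` I'_plus R k `|` I''_minus R k `|` I''_plus R k.
Proof.
move=> k0; have [h1 h2 h3 h4] := I_breaks k0.
rewrite /I_ /I'_minus /I'_plus /I''_minus /I''_plus.
apply/seteqP; split => x /=.
  rewrite in_itv /=; move=> /andP[l r].
  have [a|a] := leP x ((2 * k%:R + 1) / k%:R); first by left; left; left; rewrite in_itv /= l a.
  have [a'|a'] := leP x (I_mid R k); first by left; left; right; rewrite in_itv /= a' (ltW a).
  have [a''|a''] := leP x (4 * k%:R / (2 * k%:R - 1)); first by left; right; rewrite in_itv /= a'' (ltW a').
  by right; rewrite in_itv /= (ltW a'') r.
by case=> [[[|]|]|]; rewrite !in_itv /= => /andP[l r]; apply/andP; split; lra.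
Qed.

Lemma I_end_gt2 (k : nat) : (0 < k)%N -> 2 < I_end R k.
Proof.
move=> k0; have k1 : (1 : R) <= k%:R by rewrite ler1n.
by have d1 := I_end_denom_gt0 k0; rewrite /I_end ltr_pdivlMr //; nra.
Qed.

Lemma I_end_anti (k : nat) : (0 < k)%N -> I_end R k.+1 <= I_end R k.
Proof.
by move=> /I_breaks[h1 h2 h3 h4]; do 3 ![apply: le_trans h1 _|apply: le_trans h2 _|apply: le_trans h3 _].
Qed.

Lemma I_end1 : I_end R 1 = 16 / 3.
Proof. by rewrite /I_end; field. Qed.

Lemma I_end_le163 (k : nat) : (0 < k)%N -> I_end R k <= 16 / 3.
Proof.
case: k => // k _; elim: k => [|k IHk]; first by rewrite I_end1.
by apply: le_trans IHk; apply: I_end_anti.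
Qed.

Lemma I_cover (x : R) : 2 < x -> x <= 16 / 3 -> exists2 k : nat, (0 < k)%N & I_ R k x.
Proof.
move=> x2 x3.
have [n hn] : exists n, I_end R n.+1 < x.
  (* As [I_end R n.+1] exceeds 2 by (8n + 10) / (8n^2 + 12n + 3), the condition n(x - 2) > 12 is
     ample. *)
  have [n hn] : exists n : nat, 12 / (x - 2) < n%:R.
    exists (Num.truncn (12 / (x - 2))).+1; rewrite truncnS_gt //.
  exists n.
  move: hn; rewrite ltr_pdivrMr ?subr_gt0 // => hn.
  have d := @I_end_denom_gt0 n.+1 isT.
  rewrite /I_end ltr_pdivrMr //.
  move: d; rewrite -[n.+1%:R]natr1; have := ler0n R n; move: (n%:R) hn => y hn y0 d.
  have : 0 <= ((x - 2) * y - 12) * (8 * y + 12) by apply: mulr_ge0; lra.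
  nra.
(* Descend to the first end point below x; the preceding one closes the interval containing x. *)
elim: n hn => [|n IHn] hn; first by move: hn; rewrite I_end1; lra.
have [h|h] := ltP (I_end R n.+1) x; first exact: IHn.
by exists n.+1 => //; rewrite /I_ /= in_itv /= h (ltW hn).
Qed.

Lemma I_union : `[2, 16 / 3]%classic = [set 2 : R] `|` \bigcup_(k in [set k | (0 < k)%N]) I_ R k.
Proof.
apply/seteqP; split => x /=; rewrite in_itv /=.
  move=> /andP[]; rewrite le_eqVlt => /orP[/eqP <- _|x2 x3]; first by left.
  by right; have [k k0 hk] := I_cover x2 x3; exists k.
case=> [->|[k /= k0]]; first by apply/andP; split; lra.
rewrite /I_ /= in_itv /= => /andP[l r]; apply/andP; split.
  by apply/ltW/(lt_le_trans _ l)/I_end_gt2.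
by apply: le_trans r _; apply: I_end_le163.
Qed.

End Intervals.

(** * The four cases of the theorem *)

Lemma good_pair_succ (k : nat) : (0 < k)%N -> good_pair k (k + 1) /\ good_pair (k + 1) k.
Proof. by move=> k0; split; exists k => //; [constructor 1|constructor 2]; rewrite addn1. Qed.

Lemma good_pair_odd (k : nat) : (0 < k)%N ->
  good_pair (2 * k + 1) (2 * k + 3) /\ good_pair (2 * k + 3) (2 * k + 1).
Proof. by move=> k0; split; exists k => //; [constructor 3|constructor 4]; lia. Qed.

(** Since p < 0 and b < c, q is at least 2, and q = 2 would make c even. *)
Lemma quotient_eq3 (b c : nat) (p q : int) : (b < c)%N -> coprime 4 c ->
  c%:Z = 4 * p + q * b%:Z -> q < 4 -> p < 0 -> (c + 4 * `|p| = 3 * b)%N.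
Proof.
move=> hbc copc hc q4 p0.
have q1 : 1 < q by nia.
have [q2|q3] : q = 2 \/ q = 3 by lia.
  have : odd c by rewrite -coprime2n; apply: coprime_dvdl copc.
  by subst; lia.
by subst; lia.
Qed.

Theorem theorem1p4 (R : realType) (F : fieldType) (b c : nat) (p q : int)
    (Q : 'I_3 -> F)
    (h4b : (4 < b)%N) (hbc : (b < c)%N)
    (cop4b : coprime 4 b) (cop4c : coprime 4 c) (copbc : coprime b c)
    (hc : c%:Z = 4 * p + q * b%:Z) (hq0 : 0 <= q) (hq4 : q < 4)
    (hQ : forall i, Q i != 0)
    (hp : p < 0) :
  let t : R := b%:R / (- p)%:~R in
  [/\ (gamma_expected R F 4 b c <= gamma_Q 4 b c Q (1 : R))%E,
      [/\ 2 < t,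
          `[2, 16 / 3]%classic = [set 2] `|` \bigcup_(k in [set k | (0 < k)%N]) I_ R k,
          forall k : nat, (0 < k)%N ->
            I_ R k = I'_minus R k `|` I'_plus R k
                     `|` I''_minus R k `|` I''_plus R k &
          t < 16 / 3 -> exists2 k : nat, (0 < k)%N & I_ R k t] &
      forall k : nat, (0 < k)%N ->
        [/\ I'_minus R k t ->
              computed_by F 4 b c ((2 * k + 3)%:R / c%:R : R) (4 * (k + 1)),
            I'_plus R k t ->
              computed_by F 4 b c ((2 * k + 1)%:R / b%:R : R) (4 * (k + 1)),
            I''_minus R k t ->
              computed_by F 4 b c ((k + 1)%:R / c%:R : R) (2 * k + 1) &
            I''_plus R k t ->
              computed_by F 4 b c (k%:R / b%:R : R) (2 * k + 1)]].
Proof.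
move=> t.
have hP := quotient_eq3 hbc cop4c hc hq4 hp.
set P := `|p|%N in hP.
have P0 : (0 < P)%N by rewrite /P; lia.
have b0 : (0 < b)%N by lia.
have c0 : (0 < c)%N by lia.
have tE : t = b%:R / P%:R.
  by rewrite /t; congr (_ / _); rewrite -[P%:R]/((P%:Z)%:~R); congr (_%:~R); rewrite /P; lia.
have PR : 0 < P%:R :> R by rewrite ltr0n.
have bR : 0 < b%:R :> R by rewrite ltr0n.
have cR : c%:R = 3 * b%:R - 4 * P%:R :> R.
  by apply/eqP; rewrite eq_sym subr_eq -!natrM -natrD hP.
have t2 : 2 < t by rewrite tE ltr_pdivlMr // -natrM ltr_nat; lia.
have le_t (x y : R) : 0 < y -> x / y <= t -> x * P%:R <= b%:R * y.
  by move=> y0; rewrite tE ler_pdivrMr // mulrAC ler_pdivlMr.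
have t_le (x y : R) : 0 < y -> t <= x / y -> b%:R * y <= x * P%:R.
  by move=> y0; rewrite tE ler_pdivlMr // mulrAC ler_pdivrMr.
split.
- exact: gamma_expected_le_gamma_Q cop4b hP hQ.
- split=> //; [exact: I_union|exact: I_split|].
  by move=> t3; apply: I_cover => //; apply: ltW.
move=> k k0; have k1 : (1 : R) <= k%:R by rewrite ler1n.
have [gs gs'] := good_pair_succ k0; have [go go'] := good_pair_odd k0.
have comp := fun A B beta gamma gAB hbg hB hA =>
  @computed_by_pair F b c P b0 c0 cop4b hP A B beta gamma gAB hbg hB hA R.
split; rewrite /I'_minus /I'_plus /I''_minus /I''_plus /= in_itv /= => /andP[lo hi].
(* In each case the end point shared by the two halves of I' or I'' yields [hB], and the other end
   point yields [hA]. *)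
- have -> : (4 * (k + 1) = (2 * k + 3) + (2 * k + 1))%N by lia.
  apply: (comp _ _ c b) => //; [by right| |]; rewrite
    -(ler_nat R) ?expnS ?expn0 ?muln1 !(natrM, natrD) cR.
    by have {}hi := t_le _ _ _ hi; nra.
  have {}lo := le_t _ _ (@I_end_denom_gt0 R k.+1 isT) lo.
  by move: lo; rewrite -[k.+1%:R]natr1; nra.
- have -> : (4 * (k + 1) = (2 * k + 1) + (2 * k + 3))%N by lia.
  apply: (comp _ _ b c) => //; [by left| |]; rewrite
    -(ler_nat R) ?expnS ?expn0 ?muln1 !(natrM, natrD) cR.
    by have {}lo := le_t _ _ _ lo; nra.
  have {}hi := t_le _ _ (I_mid_denom_gt0 R k0) hi.
  nra.
- have -> : (2 * k + 1 = (k + 1) + k)%N by lia.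
  apply: (comp _ _ c b) => //; [by right| |]; rewrite
    -(ler_nat R) ?expnS ?expn0 ?muln1 !(natrM, natrD) cR.
    have {}hi := t_le _ _ _ hi; nra.
  have {}lo := le_t _ _ (I_mid_denom_gt0 R k0) lo.
  nra.
have -> : (2 * k + 1 = k + (k + 1))%N by lia.
apply: (comp _ _ b c) => //; [by left| |]; rewrite
    -(ler_nat R) ?expnS ?expn0 ?muln1 !(natrM, natrD) cR.
  have {}lo := le_t _ _ _ lo; nra.
have {}hi := t_le _ _ (I_end_denom_gt0 R k0) hi.
nra.
Qed.
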